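(* Let $a,b\ge 0$ with $a+b>0$, $\mathbf A=\begin{pmatrix}-a&b\\ a&-b\end{pmatrix}$, let $\mathbf y^*\in\mathbb R^2_{>0}$ be an arbitrary steady state of $\mathbf y'=\mathbf A\mathbf y$, i.e. $\mathbf A\mathbf y^*=\mathbf 0$, and let $\alpha\ge\frac12$, $\Delta t>0$. If $\frac12\le\alpha<1$, let $\Delta t_\alpha^*>0$ be the unique solution of $f(-\Delta t_\alpha^* a)=-\Delta t_\alpha^* b$, where $$f(\xi)=-\frac{p(\xi)}2-\sqrt{\frac{p(\xi)^2}4-q(\xi)},$$ $$p(\xi)=-\frac{2(1-\alpha\xi)(2\alpha+(1-\alpha)\xi+1)}{(2\alpha-1)(1-\alpha\xi)+\alpha\xi},\qquad q(\xi)=\frac{2(1-\alpha\xi)(2-\xi)-\xi^2}{(2\alpha-1)(1-\alpha\xi)+\alpha\xi}.$$ a) If $\alpha\ge1$, or if $\frac12\le\alpha<1$ and $\Delta t<\Delta t_\alpha^*$, then $\mathbf y^*$ is a stable fixed point of the MPRK22ncs($\alpha$) scheme with time step size $\Delta t$ applied to $\mathbf y'=\mathbf A\mathbf y$. b) If $\alpha\ge1$, or if $\frac12\le\alpha<1$ and $\Delta t<\Delta t_\alpha^*$, then there exists $\delta>0$ such that for the iterates of the MPRK22ncs($\alpha$) scheme with time step size $\Delta t$ and starting value $\mathbf y^0\in\mathbb R^2_{>0}$, the conditions $\lVert\mathbf y^0\rVert_1=\lVert\mathbf y^*\rVert_1$ and $\lVert\mathbf y^0-\mathbf y^*\rVert<\delta$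 imply $\mathbf y^n\to\mathbf y^*$ as $n\to\infty$. c) If $\frac12\le\alpha<1$ and $\Delta t>\Delta t_\alpha^*$, then $\mathbf y^*$ is an unstable fixed point of the MPRK22ncs($\alpha$) scheme with time step size $\Delta t$ applied to $\mathbf y'=\mathbf A\mathbf y$.
   Context: $\mathbb R^2_{>0}$ is the set of vectors in $\mathbb R^2$ with both components positive; $\lVert\cdot\rVert$ is an arbitrary norm and $\lVert\cdot\rVert_1$ the 1-norm. (A steady state $\mathbf y^*\in\mathbb R^2_{>0}$ exists only if $a,b>0$.) The function $f$ is considered at those $\xi<0$ where it is defined as a real number (nonzero denominators, nonnegative radicand). The system $\mathbf y'=\mathbf A\mathbf y$ is regarded as the production-destruction system $y_i'=\sum_{j=1}^2(p_{ij}(\mathbf y)-d_{ij}(\mathbf y))$ with $p_{12}(\mathbf y)=d_{21}(\mathbf y)=by_2$, $p_{21}(\mathbf y)=d_{12}(\mathbf y)=ay_1$, $p_{ii}=d_{ii}=0$. For $\alpha\ge\frac12$ and $\Delta t>0$, the MPRK22ncs($\alpha$) scheme computes $\mathbf y^{n+1}$ from $\mathbf y^n\in\mathbb R^2_{>0}$ by the linearly implicit formulas, for $i=1,2$, $$y_i^{(1)}=y_i^n,$$ $$y_i^{(2)}=y_i^n+\alpha\Delta t\sum_{j=1}^2\Bigl(p_{ij}(\mathbf y^{(1)})-d_{ij}(\mathbf y^{(1)})\frac{y_i^{(2)}}{y_i^{(1)}}\Bigr),$$ $$y_i^{n+1}=y_i^n+\Delta t\sum_{j=1}^2\Bigl(\bigl((1-\tfrac1{2\alpha})p_{ij}(\mathbf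 y^{(1)})+\tfrac1{2\alpha}p_{ij}(\mathbf y^{(2)})\bigr)\frac{y_j^{n+1}}{(y_j^{(2)})^{1/\alpha}(y_j^{(1)})^{1-1/\alpha}}-\bigl((1-\tfrac1{2\alpha})d_{ij}(\mathbf y^{(1)})+\tfrac1{2\alpha}d_{ij}(\mathbf y^{(2)})\bigr)\frac{y_i^{n+1}}{(y_i^{(2)})^{1/\alpha}(y_i^{(1)})^{1-1/\alpha}}\Bigr).$$ These are uniquely solvable with $\mathbf y^{(2)},\mathbf y^{n+1}\in\mathbb R^2_{>0}$, so the scheme is an iteration $\mathbf y^{n+1}=\mathbf g(\mathbf y^n)$ with $\mathbf g\colon\mathbb R^2_{>0}\to\mathbb R^2_{>0}$; a fixed point of the scheme is a fixed point of $\mathbf g$. A fixed point $\mathbf y^*$ is stable if for every $\epsilon>0$ there is $\delta>0$ such that every $\mathbf y^0\in\mathbb R^2_{>0}$ with $\lVert\mathbf y^0-\mathbf y^*\rVert<\delta$ satisfies $\lVert\mathbf y^n-\mathbf y^*\rVert<\epsilon$ for all $n\ge0$; it is unstable if it is not stable. *)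

(* Defs.v *)
From HB Require Import structures.
From mathcomp Require Import all_boot all_order all_algebra.
From mathcomp Require Import all_classical all_reals all_analysis.
From mathcomp Require Import ring lra.
Import Order.TTheory GRing.Theory Num.Theory.
Import numFieldNormedType.Exports.

Set Implicit Arguments.
Unset Strict Implicit.
Unset Printing Implicit Defensive.

Local Open Scope classical_set_scope.
Local Open Scope ring_scope.

Section Norms.
Context {R : realType}.
Implicit Types (nrm : 'cV[R]_2 -> R) (y : 'cV[R]_2).

Record is_norm nrm : Prop := IsNorm {
  is_norm_triangle : forall y z, nrm (y + z) <= nrm y + nrm z;
  is_norm_scale : forall (c : R) y, nrm (c *: y) = `|c| * nrm y;
  is_norm_eq0 : forall y, nrm y = 0 -> y = 0 }.

Definition norm1 y : R := \sum_(i < 2) `|y i 0|.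

Definition positive_vec y : Prop := forall i, 0 < y i 0.

End Norms.

Section LinearSystem.
Context {R : realType}.

Definition sysA (a b : R) : 'M[R]_2 :=
  \matrix_(i, j) if j == 0 then (if i == 0 then - a else a)
                 else (if i == 0 then b else - b).

(* Indices are 0-based: lin_p _ _ 0 1 is $p_{12}$. *)
Definition lin_p (a b : R) (i j : 'I_2) (y : 'cV[R]_2) : R :=
  if (i == 0) && (j == 1) then b * y 1 0
  else if (i == 1) && (j == 0) then a * y 0 0
  else 0.

Definition lin_d (a b : R) (i j : 'I_2) (y : 'cV[R]_2) : R := lin_p a b j i y.

End LinearSystem.

Section Scheme.
Context {R : realType}.
Variables (p d : 'I_2 -> 'I_2 -> 'cV[R]_2 -> R) (alpha dt : R).
Implicit Types y z : 'cV[R]_2.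

(* y2 solves the equations for the second stage; the first stage is y. *)
Definition mprk22ncs_stage y y2 : Prop := forall i : 'I_2,
  y2 i 0 = y i 0
    + alpha * dt * \sum_(j < 2) (p i j y - d i j y * (y2 i 0 / y i 0)).

Definition mprk22ncs_weight y y2 (i : 'I_2) : R :=
  (y2 i 0) `^ (alpha^-1) * (y i 0) `^ (1 - alpha^-1).

Definition mprk22ncs_update y y2 z : Prop := forall i : 'I_2,
  z i 0 = y i 0 + dt * \sum_(j < 2)
    (((1 - (2 * alpha)^-1) * p i j y + (2 * alpha)^-1 * p i j y2)
       * (z j 0 / mprk22ncs_weight y y2 j)
     - ((1 - (2 * alpha)^-1) * d i j y + (2 * alpha)^-1 * d i j y2)
       * (z i 0 / mprk22ncs_weight y y2 i)).

Definition mprk22ncs_step y z : Prop :=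
  exists y2, mprk22ncs_stage y y2 /\ mprk22ncs_update y y2 z.

(* For the linear system and positive y, the vector z exists, is unique and
   is positive (mprk22ncs_solvable and mprk22ncs_mapP below). *)
Definition mprk22ncs_map y : 'cV[R]_2 := xget y [set z | mprk22ncs_step y z].

End Scheme.

Section Stability.
Context {R : realType}.
Variables (nrm : 'cV[R]_2 -> R) (g : 'cV[R]_2 -> 'cV[R]_2).

Definition stable_at (ystar : 'cV[R]_2) : Prop :=
  forall eps : R, 0 < eps -> exists2 delta : R, 0 < delta &
    forall y0, positive_vec y0 -> nrm (y0 - ystar) < delta ->
      forall n, nrm (iter n g y0 - ystar) < eps.

Definition stable_fixed_point (ystar : 'cV[R]_2) : Prop :=
  g ystar = ystar /\ stable_at ystar.

Definition unstable_fixed_point (ystar : 'cV[R]_2) : Prop :=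
  g ystar = ystar /\ ~ stable_at ystar.

End Stability.

Section CriticalStep.
Context {R : realType}.
Implicit Types alpha xi t : R.

Definition crit_den alpha xi : R :=
  (2 * alpha - 1) * (1 - alpha * xi) + alpha * xi.

Definition crit_p alpha xi : R :=
  - (2 * (1 - alpha * xi) * (2 * alpha + (1 - alpha) * xi + 1)
     / crit_den alpha xi).

Definition crit_q alpha xi : R :=
  (2 * (1 - alpha * xi) * (2 - xi) - xi ^+ 2) / crit_den alpha xi.

Definition crit_rad alpha xi : R := crit_p alpha xi ^+ 2 / 4 - crit_q alpha xi.

Definition crit_f alpha xi : R :=
  - crit_p alpha xi / 2 - Num.sqrt (crit_rad alpha xi).

(* Needed because division by 0 and Num.sqrt of a negative number are total. *)
Definition crit_dom alpha xi : Prop :=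
  [/\ xi < 0, crit_den alpha xi != 0 & 0 <= crit_rad alpha xi].

Definition critical_step (a b alpha t : R) : Prop :=
  [/\ 0 < t, crit_dom alpha (- (t * a)) &
      crit_f alpha (- (t * a)) = - (t * b)].

End CriticalStep.

Section Solvability.
Context {R : realType}.
Implicit Types (a b alpha dt : R) (y z : 'cV[R]_2).

Lemma forall_ord2 (P : 'I_2 -> Prop) : P 0 -> P 1 -> forall i, P i.
Proof.
by move=> P0 P1 [[|[|//]] lti]; [move: P0 | move: P1]; congr P; apply/val_inj.
Qed.

Lemma sum_ord2 (F : 'I_2 -> R) : \sum_(j < 2) F j = F 0 + F 1.
Proof.
rewrite !big_ord_recl big_ord0 addr0.
by congr (F _ + F _); apply/val_inj.
Qed.

Lemma sysA_prod_dest a b y (i : 'I_2) :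
  (sysA a b *m y) i 0 = \sum_(j < 2) (lin_p a b i j y - lin_d a b i j y).
Proof.
rewrite mxE !sum_ord2 !mxE /lin_d /lin_p.
by move: i; apply: forall_ord2 => /=; ring.
Qed.

Lemma linear2_solvable (u v y0 y1 : R) :
  0 <= u -> 0 <= v -> 0 < y0 -> 0 < y1 ->
  exists z0 z1 : R, [/\ 0 < z0, 0 < z1 &
    forall x0 x1, (x0 = y0 + (v * x1 - u * x0) /\ x1 = y1 + (u * x0 - v * x1))
                  <-> (x0 = z0 /\ x1 = z1)].
Proof.
move=> u0 v0 y0p y1p; have dp : 0 < 1 + u + v by lra.
have dn : 1 + u + v != 0 by rewrite gt_eqF.
exists (((1 + v) * y0 + v * y1) / (1 + u + v)),
  (((1 + u) * y1 + u * y0) / (1 + u + v)); split.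
- by rewrite divr_gt0// ltr_wpDr ?mulr_gt0 ?mulr_ge0 ?(ltW y1p)//; lra.
- by rewrite divr_gt0// ltr_wpDr ?mulr_gt0 ?mulr_ge0 ?(ltW y0p)//; lra.
- move=> x0 x1; split=> [[e0 e1]|[-> ->]]; last by split; field.
  have f0 : (1 + u) * x0 - v * x1 = y0 by rewrite [in LHS]mulrDl mul1r {1}e0; ring.
  have f1 : (1 + v) * x1 - u * x0 = y1 by rewrite [in LHS]mulrDl mul1r {1}e1; ring.
  by rewrite -f0 -f1; split; field.
Qed.

Lemma mprk22ncs_solvable a b alpha dt y :
  0 <= a -> 0 <= b -> 2^-1 <= alpha -> 0 < dt -> positive_vec y ->
  exists y2 z, [/\ positive_vec y2, positive_vec z &
    forall x2 x, (mprk22ncs_stage (lin_p a b) (lin_d a b) alpha dt y x2 /\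
                  mprk22ncs_update (lin_p a b) (lin_d a b) alpha dt y x2 x)
                 <-> (x2 = y2 /\ x = z)].
Proof.
move=> a0 b0 al0 dt0 yp.
have alp : 0 < alpha by lra.
have [y0p y1p] := (yp 0, yp 1).
have [y0n y1n] : y 0 0 != 0 /\ y 1 0 != 0 by rewrite !gt_eqF.
have adt : 0 <= alpha * dt by rewrite mulr_ge0// ltW.
have dap : 0 < 1 + alpha * dt * a by rewrite ltr_wpDr// mulr_ge0.
have dbp : 0 < 1 + alpha * dt * b by rewrite ltr_wpDr// mulr_ge0.
have [dan dbn] : 1 + alpha * dt * a != 0 /\ 1 + alpha * dt * b != 0.
  by rewrite !gt_eqF.
pose w0 := (y 0 0 + alpha * dt * (b * y 1 0)) / (1 + alpha * dt * a).
pose w1 := (y 1 0 + alpha * dt * (a * y 0 0)) / (1 + alpha * dt * b).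
pose y2 : 'cV[R]_2 := \col_i if i == 0 then w0 else w1.
have y20 : y2 0 0 = w0 by rewrite mxE.
have y21 : y2 1 0 = w1 by rewrite mxE.
have w0p : 0 < w0 by rewrite divr_gt0// ltr_wpDr// !mulr_ge0// ltW.
have w1p : 0 < w1 by rewrite divr_gt0// ltr_wpDr// !mulr_ge0// ltW.
have y2p : positive_vec y2 by apply: forall_ord2; rewrite ?y20 ?y21.
have stE x2 : mprk22ncs_stage (lin_p a b) (lin_d a b) alpha dt y x2 <-> x2 = y2.
  split=> [st|->].
    apply/matrixP => i j; rewrite (ord1 j) {j}.
    move: (st 0) (st 1); rewrite !sum_ord2 /lin_d /lin_p /= => e0 e1.
    move: i; apply: forall_ord2; rewrite ?y20 ?y21.
      apply: (mulIf dan); rewrite divfK// mulrDr mulr1 {1}e0; by field.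
    apply: (mulIf dbn); rewrite divfK// mulrDr mulr1 {1}e1; by field.
  apply: forall_ord2; rewrite !sum_ord2 /lin_d /lin_p /= ?y20 ?y21 /w0 /w1.
    by field; rewrite ?dan ?y0n ?y1n.
  by field; rewrite ?dbn ?y0n ?y1n.
pose c := (2 * alpha)^-1.
have c0 : 0 <= c by rewrite invr_ge0 mulr_ge0// ltW.
have c1 : 0 <= 1 - c by rewrite subr_ge0 invf_le1 ?mulr_gt0//; lra.
pose s i := mprk22ncs_weight alpha y y2 i.
have sp i : 0 < s i by rewrite /s /mprk22ncs_weight mulr_gt0// powR_gt0.
pose u := dt * (((1 - c) * (a * y 0 0) + c * (a * w0)) / s 0).
pose v := dt * (((1 - c) * (b * y 1 0) + c * (b * w1)) / s 1).
have u0 : 0 <= u.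
  rewrite mulr_ge0 ?(ltW dt0)// divr_ge0 ?(ltW (sp _))//.
  by rewrite addr_ge0// mulr_ge0// mulr_ge0// ltW.
have v0 : 0 <= v.
  rewrite mulr_ge0 ?(ltW dt0)// divr_ge0 ?(ltW (sp _))//.
  by rewrite addr_ge0// mulr_ge0// mulr_ge0// ltW.
have [z0 [z1 [z0p z1p zP]]] := linear2_solvable u0 v0 y0p y1p.
exists y2, (\col_i if i == 0 then z0 else z1); split=> //.
  by apply: forall_ord2; rewrite mxE.
have upE x : mprk22ncs_update (lin_p a b) (lin_d a b) alpha dt y y2 x <->
    (x 0 0 = y 0 0 + (v * x 1 0 - u * x 0 0) /\
     x 1 0 = y 1 0 + (u * x 0 0 - v * x 1 0)).
  have E0 : y 0 0 + (v * x 1 0 - u * x 0 0) =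
    y 0 0 + dt * \sum_(j < 2)
    (((1 - c) * lin_p a b 0 j y + c * lin_p a b 0 j y2) * (x j 0 / s j)
     - ((1 - c) * lin_d a b 0 j y + c * lin_d a b 0 j y2) * (x 0 0 / s 0)).
    by rewrite !sum_ord2 /lin_d /lin_p /= y20 y21 /u /v; ring.
  have E1 : y 1 0 + (u * x 0 0 - v * x 1 0) =
    y 1 0 + dt * \sum_(j < 2)
    (((1 - c) * lin_p a b 1 j y + c * lin_p a b 1 j y2) * (x j 0 / s j)
     - ((1 - c) * lin_d a b 1 j y + c * lin_d a b 1 j y2) * (x 1 0 / s 1)).
    by rewrite !sum_ord2 /lin_d /lin_p /= y20 y21 /u /v; ring.
  rewrite E0 E1; split=> [up|[? ?]]; first by split; exact: up.
  exact: forall_ord2.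
move=> x2 x; split=> [[/stE -> /upE /zP [e0 e1]]|[-> ->]]; split => //.
- by apply/matrixP => i j; rewrite (ord1 j) mxE; move: i; apply: forall_ord2.
- exact/stE.
- by apply/upE/zP; rewrite !mxE.
Qed.

Lemma mprk22ncs_mapP a b alpha dt y z :
  0 <= a -> 0 <= b -> 2^-1 <= alpha -> 0 < dt -> positive_vec y ->
  positive_vec (mprk22ncs_map (lin_p a b) (lin_d a b) alpha dt y) /\
  (mprk22ncs_step (lin_p a b) (lin_d a b) alpha dt y z <->
   z = mprk22ncs_map (lin_p a b) (lin_d a b) alpha dt y).
Proof.
move=> a0 b0 al0 dt0 yp.
have [y2 [z' [_ z'p H]]] := mprk22ncs_solvable a0 b0 al0 dt0 yp.
have stepE x : mprk22ncs_step (lin_p a b) (lin_d a b) alpha dt y x <-> x = z'.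
  split=> [[x2 /H[]//]|->]; by exists y2; apply/H.
have -> : mprk22ncs_map (lin_p a b) (lin_d a b) alpha dt y = z'.
  by apply/stepE; apply: (@xgetI _ _ _ z'); apply/stepE.
by split.
Qed.

End Solvability.

(* Main.v *)
Require Import Defs.
From mathcomp Require Import all_boot all_order all_algebra.
From mathcomp Require Import all_classical all_reals all_analysis.
From mathcomp Require Import ring lra.
Import Order.TTheory GRing.Theory Num.Theory.
Import numFieldNormedType.Exports.

(**
The scheme conserves the total y_1 + y_2 and is homogeneous of degree 1: the
rates are linear, and the weight (y^(2))^(1/alpha) y^(1-1/alpha) has degree 1.
Hence, writing y = S (x, 1 - x) with total S and share x, the scheme keeps S and
acts on x by a scalar map h that does not depend on S ([mprk22ncs_of_share]).
A positive steady state forces a, b > 0 and has the share xs = b / (a + b),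
which is a fixed point of h. All three claims are therefore about the fixed
point xs of h: perturbations of the total persist unchanged, and perturbations
of the share follow the one-dimensional dynamics of h.

With A = a dt and B = b dt, the multiplier is ([is_derive_share_map])
  h'(xs) = (1 - (A + B) / 2 (A / (1 + alpha A) + B / (1 + alpha B)))
            / (1 + A + B).
It is always below 1, and 1 + h'(xs) is a positive multiple of
  Q = 2 (2 + A + B) (1 + alpha A) (1 + alpha B)
      - (A + B) (A + B + 2 alpha A B)
([share_mult_stab_num]). So Q > 0 makes h a local contraction, whereas Q < 0
gives a multiplier below -1, and shares starting near xs are expelled.

It remains to relate the sign of Q to the critical step. Read as a quadratic
polynomial in B, Q has the coefficients of the quadratic whose lower root, in
the variable -B, is f(-A). At a zero of Q with A, B > 0 the leading coefficient
is negative and the constant term is positive, so the two roots in B have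
opposite signs and B is the one selected by f ([crit_fP]). Read as a polynomial
in dt, Q = c0 + c1 dt + c2 dt^2 + c3 dt^3 with c0, c1 > 0 and c2 >= 0, and c3
has the sign of alpha - 1. Since Q / dt^3 - c3 decreases from +oo to 0, Q is
positive for alpha >= 1; for alpha < 1 it has exactly one positive zero, is
positive before it and negative after it.
*)

Set Implicit Arguments.
Unset Strict Implicit.
Unset Printing Implicit Defensive.

Local Open Scope classical_set_scope.
Local Open Scope ring_scope.

(** * Fixed points of scalar maps *)

Section Dynamics.
Context {R : realType}.
Implicit Types (f : R -> R) (x m : R).

Lemma is_derive_local_linear f x m e : is_derive x 1 f m -> 0 < e ->
  exists2 r, 0 < r & forall t, `|t - x| < r ->
    `|f t - f x - m * (t - x)| <= e * `|t - x|.
Proof.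
move=> [fd fm] e0.
have /cvgrPdist_le /(_ e e0) : (fun h => h^-1 *: ((f \o shift x) (h *: 1) - f x))
    @ 0^' --> m by rewrite -fm; exact: fd.
rewrite /dnbhs /within /= => /nbhs_ballP[r /= r0 rP].
exists r => // t tr; have [->|tx] := eqVneq t x.
  by rewrite !subrr mulr0 subrr normr0 mulr0.
have h0 : t - x != 0 by rewrite subr_eq0.
have /= := rP (t - x); rewrite -ball_normE /= sub0r normrN => /(_ tr h0).
rewrite /GRing.scale /= mulr1 subrK => H.
have -> : f t - f x - m * (t - x) =
    - ((m - (t - x)^-1 * (f t - f x)) * (t - x)) by field.
by rewrite normrN normrM ler_wpM2r.
Qed.

Lemma is_derive_contract f x m l : is_derive x 1 f m -> `|m| < l ->
  exists2 r, 0 < r & forall t, `|t - x| < r -> `|f t - f x| <= l * `|t - x|.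
Proof.
move=> fd ml; have [|r r0 rP] := is_derive_local_linear (e := l - `|m|) fd.
  by rewrite subr_gt0.
exists r => // t /rP; rewrite mulrBl -normrM.
have := ler_normD (f t - f x - m * (t - x)) (m * (t - x)).
by rewrite subrK; lra.
Qed.

Lemma is_derive_expand f x m l : is_derive x 1 f m -> l < `|m| ->
  exists2 r, 0 < r & forall t, `|t - x| < r -> l * `|t - x| <= `|f t - f x|.
Proof.
move=> fd ml; have [|r r0 rP] := is_derive_local_linear (e := `|m| - l) fd.
  by rewrite subr_gt0.
exists r => // t /rP; rewrite mulrBl -normrM distrC.
have := ler_normD (m * (t - x) - (f t - f x)) (f t - f x).
by rewrite subrK; lra.
Qed.

Lemma iter_contract f x l r : 0 <= l <= 1 -> f x = x ->
  (forall t, `|t - x| < r -> `|f t - f x| <= l * `|t - x|) ->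
  forall n t, `|t - x| < r -> `|iter n f t - x| <= l ^+ n * `|t - x|.
Proof.
move=> /andP[l0 l1] fx fc n t tr; elim: n => [|n IHn]; first by rewrite mul1r.
have nr : `|iter n f t - x| < r.
  by rewrite (le_lt_trans IHn)// (le_lt_trans _ tr)// ler_piMl// exprn_ile1.
have -> : iter n.+1 f t - x = f (iter n f t) - f x by rewrite fx.
rewrite (le_trans (fc _ nr))//.
by rewrite exprS -mulrA ler_wpM2l.
Qed.

(** While an orbit stays within [r] of [x], its distance to [x] grows at least
like [l ^+ n], which is unbounded. *)
Lemma iter_expand_escape f x l r : 1 < l -> 0 < r -> f x = x ->
  (forall t, `|t - x| < r -> l * `|t - x| <= `|f t - f x|) ->
  forall t, t != x -> exists n, r <= `|iter n f t - x|.
Proof.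
move=> l1 r0 fx fe t tx; apply: contrapT => /forallNP stay.
have l0 : 0 < l by lra.
have {}stay n : `|iter n f t - x| < r by rewrite ltNge; apply/negP/stay.
have grow n : l ^+ n * `|t - x| <= `|iter n f t - x|.
  elim: n => [|n IHn]; first by rewrite mul1r.
  have -> : iter n.+1 f t - x = f (iter n f t) - f x by rewrite fx.
  rewrite (le_trans _ (fe _ (stay n)))//.
  by rewrite exprS -mulrA ler_wpM2l// ltW.
have d0 : 0 < `|t - x| / r by rewrite divr_gt0// normr_gt0 subr_eq0.
have : `|l^-1| < 1 by rewrite gtr0_norm ?invr_gt0// invf_lt1.
move=> /cvg_expr /cvgr0Pnorm_lt /(_ _ d0) [n _ /(_ n (leqnn n))].
rewrite normrX gtr0_norm ?invr_gt0// exprVn ltr_pdivlMr// mulrC.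
rewrite ltr_pdivrMr ?exprn_gt0// mulrC.
by move=> /ltW /le_lt_trans /(_ (le_lt_trans (grow n) (stay n))) ; rewrite ltxx.
Qed.

End Dynamics.

(** * The polynomial behind the critical step *)

Section CriticalPolynomial.
Context {R : realType}.
Implicit Types a b alpha t A B : R.

(** The numerator of [1 + share_mult alpha A B], see [share_mult_stab_num]; its
sign decides stability. *)
Definition stab_num alpha A B : R :=
  2 * (2 + A + B) * (1 + alpha * A) * (1 + alpha * B)
  - (A + B) * (A + B + 2 * alpha * A * B).

(** The coefficients in [B] are, up to the factor [crit_den alpha (- A)], those
of the quadratic that defines [crit_f] at [- A], in the variable [- B]. *)
Lemma stab_num_quadratic alpha A B :
  crit_den alpha (- A) * B ^+ 2
  + 2 * (1 + alpha * A) * (2 * alpha - (1 - alpha) * A + 1) * B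
  + (2 * (1 + alpha * A) * (2 + A) - A ^+ 2) = stab_num alpha A B.
Proof. by rewrite /crit_den /stab_num; ring. Qed.

(** Along the ray of step sizes only the sign of the cubic coefficient depends on
whether [alpha < 1]; the constant and linear ones are positive, the quadratic one
nonnegative. *)
Lemma stab_num_cubic alpha a b t :
  stab_num alpha (t * a) (t * b) =
  4 + (2 + 4 * alpha) * (a + b) * t
  + (4 * alpha ^+ 2 * a * b + (2 * alpha - 1) * (a + b) ^+ 2) * t ^+ 2
  + 2 * alpha * (alpha - 1) * a * b * (a + b) * t ^+ 3.
Proof. by rewrite /stab_num; ring. Qed.

(** A nonnegative leading coefficient in [B] means
[2 alpha (1 - alpha) A <= 2 alpha - 1]. The coefficient of [B] is then
nonnegative too, the constant one is positive, and no root [B > 0] is left. *)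
Lemma stab_num_eq0_den alpha A B : 2^-1 <= alpha -> 0 < A -> 0 < B ->
  stab_num alpha A B = 0 -> crit_den alpha (- A) < 0.
Proof.
move=> al A0 B0; rewrite -stab_num_quadratic => Q0.
rewrite ltNge; apply/negP => D0.
have al0 : 0 < alpha by lra.
have aA : 0 < alpha * A by rewrite mulr_gt0.
have E0 : 0 <= 2 * alpha - (1 - alpha) * A + 1.
  have : 0 <= 2 * alpha * (2 * alpha - (1 - alpha) * A + 1).
    by move: D0; rewrite /crit_den; nra.
  by rewrite pmulr_rge0//; lra.
have C0 : 0 < 2 * (1 + alpha * A) * (2 + A) - A ^+ 2.
  have : 0 <= (2 * alpha - 1) * A ^+ 2 by rewrite mulr_ge0 ?sqr_ge0//; lra.
  by nra.
have : 0 <= crit_den alpha (- A) * B ^+ 2 by rewrite mulr_ge0// sqr_ge0.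
have : 0 <= 2 * (1 + alpha * A) * (2 * alpha - (1 - alpha) * A + 1) * B.
  by rewrite !mulr_ge0//; lra.
lra.
Qed.

(** At a root the leading coefficient [D] is negative and the constant term [C]
is positive. The roots in [B] thus have opposite signs, the discriminant is
positive, and the positive root is the larger one; in the variable [- B] this is
the lower one, the branch with the minus sign in [crit_f]. *)
Lemma crit_fP alpha A B : 2^-1 <= alpha -> 0 < A -> 0 < B ->
  (crit_dom alpha (- A) /\ crit_f alpha (- A) = - B) <->
  stab_num alpha A B = 0.
Proof.
move=> al A0 B0.
have al0 : 0 < alpha by lra.
set D := crit_den alpha (- A).
pose E := 2 * (1 + alpha * A) * (2 * alpha - (1 - alpha) * A + 1).
pose C := 2 * (1 + alpha * A) * (2 + A) - A ^+ 2.
have pE : crit_p alpha (- A) = - (E / D).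
  by rewrite /crit_p -/D /E; congr (- (_ / _)); ring.
have qE : crit_q alpha (- A) = C / D.
  by rewrite /crit_q -/D /C; congr (_ / _); ring.
have QE : stab_num alpha A B = D * B ^+ 2 + E * B + C.
  by rewrite -stab_num_quadratic.
have C0 : 0 < C.
  have : 0 <= (2 * alpha - 1) * A ^+ 2 by rewrite mulr_ge0 ?sqr_ge0//; lra.
  have : 0 < alpha * A by rewrite mulr_gt0.
  by rewrite /C; nra.
split=> [[[_ Dn rad0]]|Q0].
  rewrite /crit_f => fB.
  have sE : Num.sqrt (crit_rad alpha (- A)) = B - crit_p alpha (- A) / 2 by lra.
  have := sqr_sqrtr rad0; rewrite sE {sE} /crit_rad pE qE QE => sE.
  have -> : D * B ^+ 2 + E * B + C = D * ((B - - (E / D) / 2) ^+ 2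
     - ((- (E / D)) ^+ 2 / 4 - C / D)) by field.
  by rewrite sE subrr mulr0.
have D0 : D < 0 by exact: stab_num_eq0_den Q0.
have Dn : D != 0 by rewrite lt_eqF.
have radE : crit_rad alpha (- A) = (B - crit_p alpha (- A) / 2) ^+ 2.
  rewrite /crit_rad pE qE; apply/eqP; rewrite -subr_eq0; apply/eqP.
  have -> : (- (E / D)) ^+ 2 / 4 - C / D - (B - - (E / D) / 2) ^+ 2 =
    - (D * B ^+ 2 + E * B + C) / D by field.
  by rewrite -QE Q0 oppr0 mul0r.
split; first by split; rewrite ?oppr_lt0// radE sqr_ge0.
suff p0 : 0 <= B - crit_p alpha (- A) / 2.
  by rewrite /crit_f radE sqrtr_sqr ger0_norm//; lra.
(* Eliminating E by means of the equation leaves signs that are known. *)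
have -> : B - crit_p alpha (- A) / 2 = (D * B ^+ 2 - C) / (2 * D * B).
  have -> : D * B ^+ 2 - C = 2 * D * B ^+ 2 + E * B.
    by move: Q0; rewrite QE; lra.
  by rewrite pE; field; rewrite Dn gt_eqF.
rewrite ltW// -[X in 0 < X]mulrNN -invrN divr_gt0//.
- have : D * B ^+ 2 < 0 by rewrite nmulr_rlt0// exprn_gt0.
  lra.
- by rewrite oppr_gt0 pmulr_llt0// pmulr_rlt0.
Qed.

Lemma critical_stepP a b alpha t : 0 < a -> 0 < b -> 2^-1 <= alpha ->
  critical_step a b alpha t <-> 0 < t /\ stab_num alpha (t * a) (t * b) = 0.
Proof.
move=> a0 b0 al; split=> [[t0 dom fE]|[t0 Q0]].
  by split=> //; apply/crit_fP => //; exact: mulr_gt0.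
by have [] := (crit_fP al (mulr_gt0 t0 a0) (mulr_gt0 t0 b0)).2 Q0.
Qed.

(** The cofactor of [t - s] in [t ^+ 3 * Q s - s ^+ 3 * Q t], for a cubic [Q] with
coefficients [c0], [c1], [c2], [c3]. Its positivity says that [Q t / t ^+ 3] is
decreasing on the positive axis, which gives the next two lemmas. *)
Lemma cubic_gap_gt0 (c0 c1 c2 s t : R) : 0 < c0 -> 0 < c1 -> 0 <= c2 ->
  0 < s -> 0 < t ->
  0 < c0 * (t ^+ 2 + t * s + s ^+ 2) + c1 * (t * s) * (t + s)
      + c2 * (t * s) ^+ 2.
Proof.
move=> c00 c10 c20 s0 t0; have ts0 : 0 < t * s by exact: mulr_gt0.
apply: ltr_wpDr; first by rewrite mulr_ge0// sqr_ge0.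
by apply: addr_gt0; rewrite !mulr_gt0// !addr_gt0// exprn_gt0.
Qed.

Lemma cubic_gt0_before_root (c0 c1 c2 c3 s t : R) : 0 < c0 -> 0 < c1 -> 0 <= c2 ->
  0 < s -> s < t -> c0 + c1 * t + c2 * t ^+ 2 + c3 * t ^+ 3 = 0 ->
  0 < c0 + c1 * s + c2 * s ^+ 2 + c3 * s ^+ 3.
Proof.
move=> c00 c10 c20 s0 st Q0; have t0 : 0 < t by exact: lt_trans st.
rewrite -(pmulr_rgt0 _ (exprn_gt0 3 t0)).
have -> : t ^+ 3 * (c0 + c1 * s + c2 * s ^+ 2 + c3 * s ^+ 3) =
   s ^+ 3 * (c0 + c1 * t + c2 * t ^+ 2 + c3 * t ^+ 3)
   + (t - s) * (c0 * (t ^+ 2 + t * s + s ^+ 2) + c1 * (t * s) * (t + s)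
                + c2 * (t * s) ^+ 2) by ring.
by rewrite Q0 mulr0 add0r mulr_gt0 ?subr_gt0// cubic_gap_gt0.
Qed.

Lemma cubic_lt0_after_root (c0 c1 c2 c3 s t : R) : 0 < c0 -> 0 < c1 -> 0 <= c2 ->
  0 < s -> s < t -> c0 + c1 * s + c2 * s ^+ 2 + c3 * s ^+ 3 = 0 ->
  c0 + c1 * t + c2 * t ^+ 2 + c3 * t ^+ 3 < 0.
Proof.
move=> c00 c10 c20 s0 st Q0; have t0 : 0 < t by exact: lt_trans st.
rewrite -(pmulr_rlt0 _ (exprn_gt0 3 s0)).
have -> : s ^+ 3 * (c0 + c1 * t + c2 * t ^+ 2 + c3 * t ^+ 3) =
   t ^+ 3 * (c0 + c1 * s + c2 * s ^+ 2 + c3 * s ^+ 3)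
   - (t - s) * (c0 * (t ^+ 2 + t * s + s ^+ 2) + c1 * (t * s) * (t + s)
                + c2 * (t * s) ^+ 2) by ring.
by rewrite Q0 mulr0 sub0r oppr_lt0 mulr_gt0 ?subr_gt0// cubic_gap_gt0.
Qed.

Lemma cubic_root_exists (c0 c1 c2 c3 : R) : 0 < c0 -> 0 < c1 -> 0 <= c2 ->
  c3 < 0 -> exists2 t, 0 < t & c0 + c1 * t + c2 * t ^+ 2 + c3 * t ^+ 3 = 0.
Proof.
move=> c00 c10 c20 c30.
pose p : {poly R} := c0%:P + c1 *: 'X + c2 *: 'X^2 + c3 *: 'X^3.
have pE t : p.[t] = c0 + c1 * t + c2 * t ^+ 2 + c3 * t ^+ 3.
  by rewrite /p !hornerE.
(* M >= 1 with c3 * M <= - (c0 + c1 + c2), so the cubic term dominates at M. *)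
pose M := 1 + (c0 + c1 + c2) / - c3.
have n3 : 0 < - c3 by lra.
have M1 : 1 <= M by rewrite lerDl divr_ge0//; lra.
have M0 : 0 <= M by lra.
have [|t /andP[t0 tM] /rootP] := @poly_ivt R (- p) 0 M M0.
  rewrite !hornerN !pE !expr0n /= !mulr0 !addr0 oppr_le0 oppr_ge0 (ltW c00)/=.
  have c3M : c3 * M = c3 - (c0 + c1 + c2) by rewrite /M; field; lra.
  have -> : c3 * M ^+ 3 = c3 * M * M ^+ 2 by ring.
  rewrite c3M.
  have M2 : 1 <= M ^+ 2 by rewrite exprn_ege1.
  have MM2 : M <= M ^+ 2 by rewrite expr2 ler_pMl//; lra.
  have : c0 <= c0 * M ^+ 2 by rewrite ler_peMr// ltW.
  have : c1 * M <= c1 * M ^+ 2 by rewrite ler_wpM2l// ltW.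
  have : 0 <= - c3 * M ^+ 2 by rewrite mulr_ge0//; lra.
  lra.
rewrite hornerN => /eqP; rewrite oppr_eq0 => /eqP pt0.
exists t; last by rewrite -pE.
rewrite lt_neqAle t0 andbT; apply/eqP => tE.
by move: pt0; rewrite -tE pE !expr0n /= !mulr0 !addr0; lra.
Qed.

Section Sign.
Variables (a b alpha : R).
Hypotheses (a0 : 0 < a) (b0 : 0 < b) (al : 2^-1 <= alpha).

Let c1_gt0 : 0 < (2 + 4 * alpha) * (a + b).
Proof. by move: a0 b0 al => *; rewrite mulr_gt0//; lra. Qed.

Let c2_ge0 : 0 <= 4 * alpha ^+ 2 * a * b + (2 * alpha - 1) * (a + b) ^+ 2.
Proof.
by move: a0 b0 al => *; rewrite addr_ge0// !mulr_ge0 ?sqr_ge0//; lra.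
Qed.

Lemma critical_step_exists : alpha < 1 -> exists! t, critical_step a b alpha t.
Proof.
move: al => al' al1.
have c3 : 2 * alpha * (alpha - 1) * a * b * (a + b) < 0.
  have al0 : 0 < alpha by lra.
  rewrite 3?pmulr_llt0 ?addr_gt0// pmulr_rlt0 ?mulr_gt0//; lra.
have [|t t0] := cubic_root_exists (c0 := 4) _ c1_gt0 c2_ge0 c3; first lra.
rewrite -stab_num_cubic => Qt; exists t; split; first exact/critical_stepP.
move=> s /critical_stepP[]// s0 Qs; move: Qs Qt; rewrite !stab_num_cubic.
have [st|ts|//] := ltgtP s t => Qs Qt.
- by have := cubic_lt0_after_root (ltr0n R 4) c1_gt0 c2_ge0 s0 st Qs;
     rewrite Qt ltxx.
- by have := cubic_lt0_after_root (ltr0n R 4) c1_gt0 c2_ge0 t0 ts Qt;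
     rewrite Qs ltxx.
Qed.

Lemma stab_num_gt0 dt dtstar : 0 < dt ->
  (alpha < 1 -> critical_step a b alpha dtstar) ->
  1 <= alpha \/ (alpha < 1 /\ dt < dtstar) ->
  0 < stab_num alpha (dt * a) (dt * b).
Proof.
move: a0 b0 al => a0' b0' al' dt0 crit [al1|[al1 lt]]; rewrite stab_num_cubic.
  rewrite ltr_wpDr ?ltr_wpDr ?addr_gt0 ?mulr_gt0 ?mulr_ge0 ?exprn_ge0//; try lra;
    by rewrite ?sqr_ge0// ltW// ?addr_gt0.
have /critical_stepP[]// := crit al1 => s0; rewrite stab_num_cubic.
by apply: cubic_gt0_before_root => //; exact: ltr0n.
Qed.

Lemma stab_num_lt0 dt dtstar : critical_step a b alpha dtstar -> dtstar < dt ->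
  stab_num alpha (dt * a) (dt * b) < 0.
Proof.
move=> /critical_stepP[]// s0; rewrite !stab_num_cubic => Q0 lt.
by apply: cubic_lt0_after_root lt Q0 => //; exact: ltr0n.
Qed.

End Sign.
End CriticalPolynomial.

(** * Reduction to the share and its multiplier *)

Section ShareMap.
Context {R : realType}.
Implicit Types A B S x : R.
Variable alpha : R.

(** The first component of the second stage at [(x, 1 - x)], with [A = a dt] and
[B = b dt]. Exchanging the two components of the system exchanges [A] with [B]
and [x] with [1 - x], so the second component is [share_stage B A (1 - x)]; the
same convention applies to [share_rate]. *)
Definition share_stage A B x : R :=
  (x + alpha * B * (1 - x)) / (1 + alpha * A).

(** The Patankar weight [x2 `^ alpha^-1 * x `^ (1 - alpha^-1)] as a single
exponential: this makes its homogeneity and its derivative immediate. *)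
Definition patankar_weight x x2 : R :=
  expR (alpha^-1 * ln x2 + (1 - alpha^-1) * ln x).

(** The update for [y = (x, 1 - x)] reads
[z0 = x + share_rate B A (1 - x) * z1 - share_rate A B x * z0]. *)
Definition share_rate A B x : R :=
  A * ((1 - (2 * alpha)^-1) * x + (2 * alpha)^-1 * share_stage A B x)
  / patankar_weight x (share_stage A B x).

(** The update solved for [z0], using the conservation law [z0 + z1 = 1]. *)
Definition share_map A B x : R :=
  (x + share_rate B A (1 - x))
  / (1 + share_rate A B x + share_rate B A (1 - x)).

Definition of_share S x : 'cV[R]_2 :=
  \col_i (if i == 0 then S * x else S * (1 - x)).

Lemma of_share0 S x : of_share S x 0 0 = S * x. Proof. by rewrite mxE. Qed.

Lemma of_share1 S x : of_share S x 1 0 = S * (1 - x).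
Proof. by rewrite mxE. Qed.

Lemma vec_of_share (y : 'cV[R]_2) : y 0 0 + y 1 0 != 0 ->
  y = of_share (y 0 0 + y 1 0) (y 0 0 / (y 0 0 + y 1 0)).
Proof.
move=> Sn; apply/matrixP => i j; rewrite (ord1 j).
by move: i; apply: forall_ord2; rewrite ?of_share0 ?of_share1; field.
Qed.

Lemma positive_of_share S x : 0 < S ->
  positive_vec (of_share S x) <-> 0 < x < 1.
Proof.
move=> S0; split=> [p|/andP[x0 x1]].
  have := p 0; have := p 1; rewrite of_share0 of_share1.
  by rewrite !pmulr_rgt0// subr_gt0 => -> ->.
by apply: forall_ord2; rewrite ?of_share0 ?of_share1 mulr_gt0// subr_gt0.
Qed.

Hypothesis alpha_gt0 : 0 < alpha.

Lemma share_stage_gt0 A B x : 0 < A -> 0 < B -> 0 < x < 1 ->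
  0 < share_stage A B x.
Proof.
move=> A0 B0 /andP[x0 x1]; rewrite divr_gt0 ?addr_gt0 ?mulr_gt0//.
by rewrite subr_gt0.
Qed.

(** Homogeneity of degree 1 of the weight: the exponents add up to 1. *)
Lemma patankar_weightM S x x2 : 0 < S -> 0 < x -> 0 < x2 ->
  (S * x2) `^ alpha^-1 * (S * x) `^ (1 - alpha^-1) = S * patankar_weight x x2.
Proof.
move=> S0 x0 x20.
have pE y r : 0 < y -> y `^ r = expR (r * ln y).
  by move=> y0; rewrite /powR gt_eqF.
rewrite !pE ?mulr_gt0// -expRD !lnM ?posrE// -[in RHS](lnK S0) -expRD.
by congr expR; ring.
Qed.

Lemma share_rate_ge0 A B x : 2^-1 <= alpha -> 0 < A -> 0 < B -> 0 < x < 1 ->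
  0 <= share_rate A B x.
Proof.
move=> al A0 B0 x01; have s0 := share_stage_gt0 A0 B0 x01.
case/andP: x01 => x0 x1.
have c0 : 0 <= (2 * alpha)^-1 by rewrite invr_ge0 mulr_ge0// ltW.
have c1 : 0 <= 1 - (2 * alpha)^-1.
  by rewrite subr_ge0 invf_le1 ?mulr_gt0//; move: al; lra.
by rewrite divr_ge0 ?expR_ge0// mulr_ge0 ?(ltW A0)// addr_ge0// mulr_ge0// ltW.
Qed.

(** The reduction to one dimension: the total is conserved, and by homogeneity
the new share depends on the old share only. *)
Lemma mprk22ncs_of_share a b dt S x : 2^-1 <= alpha -> 0 < a -> 0 < b ->
  0 < dt -> 0 < S -> 0 < x < 1 ->
  mprk22ncs_map (lin_p a b) (lin_d a b) alpha dt (of_share S x)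
  = of_share S (share_map (dt * a) (dt * b) x).
Proof.
move=> al a0 b0 dt0 S0 x01; have [x0 x1] := andP x01.
have w0 : 0 < 1 - x by rewrite subr_gt0.
have w01 : 0 < 1 - x < 1 by rewrite w0/= ltrBlDr ltrDl.
have yp : positive_vec (of_share S x) by apply/positive_of_share.
apply/esym/(mprk22ncs_mapP _ (ltW a0) (ltW b0) al dt0 yp).2.
set A := dt * a; set B := dt * b.
have A0 : 0 < A by exact: mulr_gt0.
have B0 : 0 < B by exact: mulr_gt0.
set s0 := share_stage A B x; set s1 := share_stage B A (1 - x).
have s0p : 0 < s0 by exact: share_stage_gt0.
have s1p : 0 < s1 by exact: share_stage_gt0.
pose y2 : 'cV[R]_2 := \col_i (if i == 0 then S * s0 else S * s1).
have y20 : y2 0 0 = S * s0 by rewrite mxE.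
have y21 : y2 1 0 = S * s1 by rewrite mxE.
have Sn : S != 0 by rewrite gt_eqF.
have xn : x != 0 by rewrite gt_eqF.
have wn : 1 - x != 0 by rewrite gt_eqF.
exists y2; split.
  have An : 1 + alpha * (dt * a) != 0 by rewrite gt_eqF// addr_gt0 ?mulr_gt0.
  have Bn : 1 + alpha * (dt * b) != 0 by rewrite gt_eqF// addr_gt0 ?mulr_gt0.
  apply: forall_ord2; rewrite !sum_ord2 /lin_d /lin_p /= ?y20 ?y21.
    by rewrite of_share0 of_share1 /s0 /share_stage /A /B; field;
       rewrite An Sn xn.
  by rewrite of_share0 of_share1 /s1 /share_stage /A /B; field;
     rewrite Bn Sn wn.
set L0 := patankar_weight x s0; set L1 := patankar_weight (1 - x) s1.
have W0 : mprk22ncs_weight alpha (of_share S x) y2 0 = S * L0.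
  by rewrite /mprk22ncs_weight y20 of_share0 patankar_weightM.
have W1 : mprk22ncs_weight alpha (of_share S x) y2 1 = S * L1.
  by rewrite /mprk22ncs_weight y21 of_share1 patankar_weightM.
have L0n : L0 != 0 by rewrite gt_eqF// expR_gt0.
have L1n : L1 != 0 by rewrite gt_eqF// expR_gt0.
set u := share_rate A B x; set v := share_rate B A (1 - x).
have dtn : dt != 0 by rewrite gt_eqF.
have aln : alpha != 0 by rewrite gt_eqF.
have uE : (1 - (2 * alpha)^-1) * (a * (S * x))
    + (2 * alpha)^-1 * (a * (S * s0)) = u * (S * L0) / dt.
  by rewrite /u /share_rate -/s0 -/L0 /A; field; rewrite L0n aln dtn.
have vE : (1 - (2 * alpha)^-1) * (b * (S * (1 - x)))
    + (2 * alpha)^-1 * (b * (S * s1)) = v * (S * L1) / dt.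
  by rewrite /v /share_rate -/s1 -/L1 /B; field; rewrite L1n aln dtn.
have dn : 1 + u + v != 0.
  by rewrite gt_eqF// -addrA ltr_pwDl// addr_ge0// share_rate_ge0.
set z := share_map A B x.
have zE : z = (x + v) / (1 + u + v) by [].
apply: forall_ord2; rewrite !sum_ord2 W0 W1 /lin_d /lin_p /= y20 y21
  !of_share0 !of_share1 uE vE -/z zE;
  field; by rewrite dn dtn L0n L1n Sn aln.
Qed.

Lemma share_map_itv a b x : 2^-1 <= alpha -> 0 < a -> 0 < b ->
  0 < x < 1 -> 0 < share_map a b x < 1.
Proof.
move=> al a0 b0 x01; apply/(positive_of_share _ ltr01).
(* The step with dt = 1 and total 1 has share_map a b x as its first entry. *)
rewrite -[a]mul1r -[b]mul1r -mprk22ncs_of_share//.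
apply: (mprk22ncs_mapP 0 (ltW a0) (ltW b0) al ltr01 _).1.
exact/positive_of_share.
Qed.

Lemma iter_mprk22ncs_of_share a b dt S x n : 2^-1 <= alpha -> 0 < a -> 0 < b ->
  0 < dt -> 0 < S -> 0 < x < 1 ->
  iter n (mprk22ncs_map (lin_p a b) (lin_d a b) alpha dt) (of_share S x)
  = of_share S (iter n (share_map (dt * a) (dt * b)) x).
Proof.
move=> al a0 b0 dt0 S0 x01; elim: n => //= n ->.
rewrite mprk22ncs_of_share//; elim: n => //= n IHn.
by apply: share_map_itv; rewrite ?mulr_gt0.
Qed.

Lemma share_stage_fixed A B : 0 < A -> 0 < B ->
  share_stage A B (B / (A + B)) = B / (A + B).
Proof.
move=> A0 B0; have al := alpha_gt0.
by rewrite /share_stage; field; rewrite !gt_eqF// addr_gt0// mulr_gt0.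
Qed.

Lemma patankar_weight_diag x : 0 < x -> patankar_weight x x = x.
Proof.
by move=> x0; rewrite /patankar_weight -mulrDl addrC subrK mul1r lnK.
Qed.

Lemma share_rate_fixed A B : 0 < A -> 0 < B ->
  share_rate A B (B / (A + B)) = A.
Proof.
move=> A0 B0; have x0 : 0 < B / (A + B) by rewrite divr_gt0 ?addr_gt0.
rewrite /share_rate share_stage_fixed// patankar_weight_diag//.
by rewrite -mulrDl subrK mul1r mulfK ?gt_eqF.
Qed.

Lemma share_compl A B : 0 < A -> 0 < B -> 1 - B / (A + B) = A / (B + A).
Proof. by move=> A0 B0; field; rewrite !gt_eqF ?addr_gt0. Qed.

Lemma share_map_fixed A B : 0 < A -> 0 < B ->
  share_map A B (B / (A + B)) = B / (A + B).
Proof.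
move=> A0 B0; rewrite /share_map share_compl// !share_rate_fixed//.
by field; rewrite !gt_eqF ?addr_gt0.
Qed.

(** The derivative of [share_map A B] at its fixed point. *)
Definition share_mult A B : R :=
  (1 - (A + B) / 2 * (A / (1 + alpha * A) + B / (1 + alpha * B)))
  / (1 + A + B).

Lemma is_derive_share_stage A B x :
  is_derive x 1 (share_stage A B) ((1 - alpha * B) / (1 + alpha * A)).
Proof.
have -> : share_stage A B = (1 + alpha * A)^-1 *:
    (id + (alpha * B) *: (cst 1 - id)) :> (R -> R).
  by apply/funext => y; rewrite /share_stage mulrC.
apply: is_derive_eq; rewrite /GRing.scale /=; ring.
Qed.

(** At the fixed point both stages agree, so that the logarithmic derivative of
the weight is [(s' / alpha + 1 - alpha^-1) / x], where
[s' = (1 - alpha B) / (1 + alpha A)] is the derivative of the stage. Most terms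
cancel against those of the numerator, leaving [A * (1 - s') / (2 alpha x)]. *)
Lemma is_derive_share_rate A B : 0 < A -> 0 < B ->
  is_derive (B / (A + B)) 1 (share_rate A B)
    (A * (A + B) / (2 * (1 + alpha * A)) / (B / (A + B))).
Proof.
move=> A0 B0; set x := B / (A + B).
have x0 : 0 < x by rewrite divr_gt0 ?addr_gt0.
have sx : share_stage A B x = x by exact: share_stage_fixed.
have Ds := is_derive_share_stage A B x.
have s0 : 0 < share_stage A B x by rewrite sx.
have Dlns := is_derive1_comp (is_derive1_ln s0) Ds.
have Dln := is_derive1_ln x0.
pose e y := - alpha^-1 * ln (share_stage A B y) - (1 - alpha^-1) * ln y.
have De : is_derive x 1 e _ := is_deriveB (is_deriveZ _ Dlns) (is_deriveZ _ Dln).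
have Dexp := is_derive1_comp (is_derive_expR (e x)) De.
pose n y := A * ((1 - (2 * alpha)^-1) * y + (2 * alpha)^-1 * share_stage A B y).
have Dn : is_derive x 1 n _ := is_deriveZ A (is_deriveD
  (is_deriveZ (1 - (2 * alpha)^-1) (is_derive_id x 1))
  (is_deriveZ ((2 * alpha)^-1) Ds)).
have -> : share_rate A B = (fun y => n y * expR (e y)).
  apply/funext => y; rewrite /share_rate /patankar_weight -expRN.
  by congr (_ * expR _); rewrite /e; ring.
have Dr := is_deriveM Dn Dexp.
apply: is_derive_eq Dr _; rewrite /GRing.scale /=.
have -> : expR (e x) = x^-1.
  by rewrite -[in RHS](lnK x0) -expRN; congr expR; rewrite /e sx; ring.
rewrite /n sx; clearbody x.
have Dn0 : 1 + alpha * A != 0 by rewrite gt_eqF// addr_gt0 ?mulr_gt0.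
by field; rewrite Dn0 !gt_eqF.
Qed.

Lemma is_derive_share_map A B : 0 < A -> 0 < B ->
  is_derive (B / (A + B)) 1 (share_map A B) (share_mult A B).
Proof.
move=> A0 B0; set x := B / (A + B).
pose c (y : R) : R := 1 - y.
have Dx : is_derive x 1 c (0 - 1).
  by exact: is_deriveB (is_derive_cst (1 : R) x 1) (is_derive_id x 1).
have Du := is_derive_share_rate A0 B0.
have Dr := is_derive_share_rate B0 A0.
have cx : c x = A / (B + A) by exact: share_compl.
rewrite -cx in Dr.
have Dv := is_derive1_comp Dr Dx.
pose v y := share_rate B A (c y).
pose d y := 1 + share_rate A B y + v y.
have Dd : is_derive x 1 d _ :=
  is_deriveD (is_deriveD (is_derive_cst (1 : R) x 1) Du) Dv.
have ux : share_rate A B x = A by exact: share_rate_fixed.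
have vx : v x = B by rewrite /v cx share_rate_fixed.
have dx : d x = 1 + A + B by rewrite /d ux vx.
have dn : d x != 0 by rewrite dx gt_eqF ?addr_gt0.
have Dm := is_deriveM (is_deriveD (is_derive_id x 1) Dv) (is_deriveV dn Dd).
apply: is_derive_eq Dm _; rewrite /GRing.scale /= /v.
have -> : (id + (share_rate B A \o c)) x = x + v x by [].
rewrite vx dx cx /x /share_mult; field.
have An : 1 + alpha * A != 0 by rewrite gt_eqF// addr_gt0 ?mulr_gt0.
have Bn : 1 + alpha * B != 0 by rewrite gt_eqF// addr_gt0 ?mulr_gt0.
have Cn : 1 + A + B != 0 by rewrite gt_eqF// !addr_gt0.
have Sn : A + B != 0 by rewrite gt_eqF// addr_gt0.
have Sn' : B + A != 0 by rewrite addrC.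
by rewrite ?(An, Bn, Cn, Sn, Sn') ?gt_eqF.
Qed.

Lemma share_mult_lt1 A B : 0 < A -> 0 < B ->
  share_mult A B < 1.
Proof.
move=> A0 B0; rewrite ltr_pdivrMr ?addr_gt0// mul1r.
have : 0 < (A + B) / 2 * (A / (1 + alpha * A) + B / (1 + alpha * B)).
  by rewrite mulr_gt0// ?addr_gt0 ?divr_gt0// ?addr_gt0 ?mulr_gt0.
lra.
Qed.

Lemma share_mult_stab_num A B : 0 < A -> 0 < B ->
  1 + share_mult A B = stab_num alpha A B
    / (2 * (1 + alpha * A) * (1 + alpha * B) * (1 + A + B)).
Proof.
move=> A0 B0; rewrite /share_mult /stab_num; field.
have An : 1 + alpha * A != 0 by rewrite gt_eqF// addr_gt0 ?mulr_gt0.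
have Bn : 1 + alpha * B != 0 by rewrite gt_eqF// addr_gt0 ?mulr_gt0.
have Cn : 1 + A + B != 0 by rewrite gt_eqF// !addr_gt0.
by rewrite An Bn Cn.
Qed.

Lemma share_mult_gtN1 A B : 0 < A -> 0 < B ->
  (-1 < share_mult A B) = (0 < stab_num alpha A B).
Proof.
move=> A0 B0; rewrite -subr_gt0 opprK addrC share_mult_stab_num//.
by rewrite pmulr_lgt0// invr_gt0 !mulr_gt0// ?addr_gt0// mulr_gt0.
Qed.

Lemma share_mult_ltN1 A B : 0 < A -> 0 < B ->
  (share_mult A B < -1) = (stab_num alpha A B < 0).
Proof.
move=> A0 B0; rewrite -subr_lt0 opprK addrC share_mult_stab_num//.
by rewrite pmulr_llt0// invr_gt0 !mulr_gt0// ?addr_gt0// mulr_gt0.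
Qed.

End ShareMap.

(** * Norms on the plane *)

Section Norms.
Context {R : realType}.
Implicit Types y z : 'cV[R]_2.

Lemma norm1E y : norm1 y = `|y 0 0| + `|y 1 0|.
Proof. by rewrite /norm1 sum_ord2. Qed.

Section NormOfVector.
Variable nrm : 'cV[R]_2 -> R.
Hypothesis nrm_norm : is_norm nrm.

Lemma is_norm0 : nrm 0 = 0.
Proof.
by rewrite -(scale0r (0 : 'cV[R]_2)) (is_norm_scale nrm_norm) normr0 mul0r.
Qed.

Lemma is_normN y : nrm (- y) = nrm y.
Proof. by rewrite -scaleN1r (is_norm_scale nrm_norm) normrN1 mul1r. Qed.

Lemma is_norm_ge0 y : 0 <= nrm y.
Proof.
have := is_norm_triangle nrm_norm y (- y).
by rewrite subrr is_norm0 is_normN; lra.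
Qed.

Lemma is_norm_dist y z : `|nrm y - nrm z| <= nrm (y - z).
Proof.
have := is_norm_triangle nrm_norm (y - z) z.
have := is_norm_triangle nrm_norm (z - y) y.
by rewrite !subrK -opprB is_normN ler_norml; lra.
Qed.

(** The norm is Lipschitz along the line and at least [nrm e] outside a bounded
segment; on the segment the extreme value theorem gives a positive minimum. *)
Lemma is_norm_line_gt0 e f : (forall t : R, e + t *: f != 0) ->
  exists2 c, 0 < c & forall t, c <= nrm (e + t *: f).
Proof.
move=> en.
have n0 y : y != 0 -> 0 < nrm y.
  by move=> yn; rewrite lt_neqAle is_norm_ge0 andbT eq_sym;
     apply: contra_neq yn => /(is_norm_eq0 nrm_norm).
have e0 : 0 < nrm e by have := n0 _ (en 0); rewrite scale0r addr0.
pose phi t := nrm (e + t *: f).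
have lip s t : `|phi s - phi t| <= `|s - t| * nrm f.
  rewrite (le_trans (is_norm_dist _ _))// opprD addrACA subrr add0r -scalerBl.
  by rewrite (is_norm_scale nrm_norm).
have f0 : 0 <= nrm f by exact: is_norm_ge0.
have cont : continuous phi.
  move=> s; apply/cvgrPdist_lt => eps eps0.
  have d0 : 0 < eps / (nrm f + 1) by rewrite divr_gt0//; lra.
  near=> t; rewrite (le_lt_trans (lip _ _))//.
  have : `|s - t| < eps / (nrm f + 1).
    by near: t; have := nbhsx_ballx s _ d0; rewrite -ball_normE.
  rewrite ltr_pdivlMr; last lra.
  by apply: le_lt_trans; rewrite ler_wpM2l//; lra.
have [M M0 far] : exists2 M, 0 <= M & forall t, M < `|t| -> nrm e <= phi t.
  have [fz|fn] := eqVneq (nrm f) 0.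
    exists 0 => // t _; have := lip t 0.
    by rewrite fz mulr0 /phi scale0r addr0 ler_norml; lra.
  have fp : 0 < nrm f by rewrite lt_neqAle eq_sym fn.
  exists (2 * nrm e / nrm f); first by rewrite divr_ge0// mulr_ge0// ltW.
  move=> t; rewrite ltr_pdivrMr// => tM.
  have := is_norm_dist e (- (t *: f)).
  by rewrite opprK is_normN (is_norm_scale nrm_norm) -/(phi t) ler_norml; lra.
have [|c _ cP] := EVT_min (_ : - M <= M) (continuous_subspaceT cont); first lra.
exists (Num.min (phi c) (nrm e)); first by rewrite lt_min e0 n0.
move=> t; have [tM|tM] := lerP `|t| M; rewrite ge_min.
  by rewrite cP// in_itv /= -ler_norml.
by rewrite (far t)// orbT.
Unshelve. all: by end_near. Qed.

(** Scaling [y] so that its [i]-th coordinate is 1 puts it on a fixed line that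
avoids the origin. *)
Lemma is_norm_coord (i j : 'I_2) : i != j ->
  exists2 c, 0 < c & forall y, c * `|y i 0| <= nrm y.
Proof.
move=> ij.
have [|c c0 cP] := @is_norm_line_gt0 (delta_mx i 0) (delta_mx j 0).
  move=> t; apply/eqP => /matrixP /(_ i 0) /eqP.
  by rewrite !mxE !eqxx (negPf ij) mulr0 addr0 oner_eq0.
exists c => // y; have [->|yi] := eqVneq (y i 0) 0.
  by rewrite normr0 mulr0 is_norm_ge0.
have -> : y = y i 0 *: (delta_mx i 0 + (y j 0 / y i 0) *: delta_mx j 0).
  apply/matrixP => k l; rewrite (ord1 l) !mxE eqxx !andbT.
  have two (p q r : 'I_2) : p != q -> (r == p) || (r == q).
    by move: p q r; do 3!apply: forall_ord2.
  case/orP: (two i j k ij) => /eqP ->.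
    by rewrite eqxx (negPf ij) mulr0 addr0 mulr1.
  by rewrite eqxx eq_sym (negPf ij) add0r mulr1 mulrC divfK.
rewrite (is_norm_scale nrm_norm) !mxE !eqxx (negPf ij) !mulr0 addr0 mulr1 mulrC.
by rewrite ler_wpM2l.
Qed.

(** Makes the smallness conditions independent of the norm: from here on
estimates are made in the 1-norm, where totals and shares are easy to read off. *)
Lemma norm1_equiv : exists c C, [/\ 0 < c, 0 < C,
  forall y, c * norm1 y <= nrm y & forall y, nrm y <= C * norm1 y].
Proof.
have [c0 c00 P0] := @is_norm_coord 0 1 isT.
have [c1 c10 P1] := @is_norm_coord 1 0 isT.
pose E i := nrm (delta_mx i 0).
exists (Num.min c0 c1 / 2), (1 + E 0 + E 1); split.
- by rewrite divr_gt0// lt_min c00.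
- have := is_norm_ge0 (delta_mx 0 0); have := is_norm_ge0 (delta_mx 1 0).
  by rewrite /E; lra.
- move=> y; have := P0 y; have := P1 y; rewrite norm1E.
  have : Num.min c0 c1 * `|y 0 0| <= c0 * `|y 0 0|.
    by rewrite ler_wpM2r// ge_min lexx.
  have : Num.min c0 c1 * `|y 1 0| <= c1 * `|y 1 0|.
    by rewrite ler_wpM2r// ge_min lexx orbT.
  lra.
- move=> y.
  have -> : nrm y = nrm (y 0 0 *: delta_mx 0 0 + y 1 0 *: delta_mx 1 0).
    congr nrm; apply/matrixP => k l; rewrite (ord1 l) !mxE.
    by move: k; apply: forall_ord2; rewrite /= ?mulr1 ?mulr0 ?addr0 ?add0r.
  rewrite (le_trans (is_norm_triangle nrm_norm _ _))//.
  rewrite !(is_norm_scale nrm_norm) norm1E -/(E 0) -/(E 1).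
  have E0 : 0 <= E 0 by exact: is_norm_ge0.
  have E1 : 0 <= E 1 by exact: is_norm_ge0.
  have := normr_ge0 (y 0 0); have := normr_ge0 (y 1 0); nra.
Qed.
End NormOfVector.

(** Turns a geometric bound in the 1-norm into convergence for the entrywise
topology of matrices. *)
Lemma cvg_norm1 (u : nat -> 'cV[R]_2) y (c l : R) : `|l| < 1 ->
  (forall n, norm1 (u n - y) <= c * l ^+ n) -> u @ \oo --> y.
Proof.
move=> l1 uP; apply/cvg_ballP => eps eps0.
have c0 : c * l ^+ n @[n --> \oo] --> 0.
  by rewrite -(mulr0 c); apply: cvgM; [exact: cvg_cst|exact: cvg_expr].
near=> n; split=> // i j; rewrite (ord1 j) -ball_normE /= distrC.
have : norm1 (u n - y) < eps.
  rewrite (le_lt_trans (uP n))// (le_lt_trans (ler_norm _))//.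
  by near: n; apply: cvgr0_norm_lt.
rewrite norm1E !mxE; apply: le_lt_trans.
by move: i; apply: forall_ord2; rewrite ?lerDl ?lerDr.
Unshelve. all: by end_near. Qed.

End Norms.

(** * Linearized stability of the scheme *)

Section ShareDistance.
Context {R : realType}.
Implicit Types S T x z : R.

Lemma norm1_of_shareB S T x z : norm1 (of_share S x - of_share T z) =
  `|S * x - T * z| + `|S * (1 - x) - T * (1 - z)|.
Proof. by rewrite norm1E !mxE. Qed.

Lemma norm1_positive (y : 'cV[R]_2) : positive_vec y ->
  norm1 y = y 0 0 + y 1 0.
Proof. by move=> yp; rewrite norm1E !gtr0_norm. Qed.

Lemma total_le_norm1 S T x z :
  `|S - T| <= norm1 (of_share S x - of_share T z).
Proof.
rewrite norm1_of_shareB.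
have -> : S - T = (S * x - T * z) + (S * (1 - x) - T * (1 - z)) by ring.
exact: ler_normD.
Qed.

(** [S (x - z)] is a combination of the two components of the difference with
coefficients [1 - z] and [- z], both of absolute value at most 1. *)
Lemma share_le_norm1 S T x z : 0 < S -> 0 < z < 1 ->
  S * `|x - z| <= norm1 (of_share S x - of_share T z).
Proof.
move=> S0 /andP[z0 z1]; rewrite norm1_of_shareB.
rewrite -[X in X * _](gtr0_norm S0) -normrM.
have -> : S * (x - z) =
  (S * x - T * z) * (1 - z) - (S * (1 - x) - T * (1 - z)) * z by ring.
rewrite (le_trans (ler_normB _ _))// lerD// normrM ler_piMr//.
  by rewrite gtr0_norm ?subr_gt0//; lra.
by rewrite gtr0_norm// ltW.
Qed.

Lemma norm1_le_total_share S T x z : 0 < S -> 0 < z < 1 ->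
  norm1 (of_share S x - of_share T z) <= `|S - T| + 2 * (S * `|x - z|).
Proof.
move=> S0 /andP[z0 z1]; rewrite norm1_of_shareB.
have -> : S * x - T * z = (S - T) * z + S * (x - z) by ring.
have -> : S * (1 - x) - T * (1 - z) = (S - T) * (1 - z) - S * (x - z) by ring.
have := ler_normD ((S - T) * z) (S * (x - z)).
have := ler_normB ((S - T) * (1 - z)) (S * (x - z)).
rewrite !normrM (gtr0_norm S0) (gtr0_norm z0) [`|1 - z|]gtr0_norm ?subr_gt0//.
lra.
Qed.

End ShareDistance.

Section LinearizedStability.
Context {R : realType}.
Variables (a b alpha dt : R).
Hypotheses (a0 : 0 < a) (b0 : 0 < b) (al : 2^-1 <= alpha) (dt0 : 0 < dt).

Let g := mprk22ncs_map (lin_p a b) (lin_d a b) alpha dt.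
Let h := share_map alpha (dt * a) (dt * b).
Let m := share_mult alpha (dt * a) (dt * b).
Let xs := dt * b / (dt * a + dt * b).

Let al0 : 0 < alpha. Proof. by apply: lt_le_trans al; rewrite invr_gt0. Qed.
Let A0 : 0 < dt * a. Proof. exact: mulr_gt0. Qed.
Let B0 : 0 < dt * b. Proof. exact: mulr_gt0. Qed.
Let hxs : h xs = xs. Proof. exact: share_map_fixed. Qed.
Let Dh : is_derive xs 1 h m. Proof. exact: is_derive_share_map. Qed.

Let xs01 : 0 < xs < 1.
Proof.
by rewrite /xs divr_gt0 ?addr_gt0// ltr_pdivrMr ?addr_gt0// mul1r ltrDr.
Qed.

(** A steady state satisfies [a y_1 = b y_2], which fixes its share but not its
total. *)
Lemma steady_of_share (y : 'cV[R]_2) : positive_vec y -> sysA a b *m y = 0 ->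
  y = of_share (norm1 y) xs.
Proof.
move=> yp /matrixP /(_ 0 0).
rewrite !mxE sum_ord2 !mxE /= norm1_positive// => ay.
have Sn : y 0 0 + y 1 0 != 0 by rewrite gt_eqF// addr_gt0.
rewrite {1}(vec_of_share Sn); congr of_share.
have ab0 : a + b != 0 by rewrite gt_eqF// addr_gt0.
have -> : xs = b / (a + b).
  by rewrite /xs -mulrDr -mulf_div divff ?mul1r ?gt_eqF.
apply/eqP; rewrite eqr_div//; apply/eqP.
by move: ay; lra.
Qed.

Lemma share_fixed_point S : 0 < S -> g (of_share S xs) = of_share S xs.
Proof. by move=> S0; rewrite /g mprk22ncs_of_share// -/h hxs. Qed.

(** The deviation [S - T] of the total is constant along the orbit while that of
the share contracts. A single bound therefore gives both stability, from
[l ^+ n <= 1], and convergence when the totals agree. The threshold [rho] keeps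
the total above [T / 2], which converts distances of vectors into distances of
shares. *)
Lemma contracting_multiplier_bound T : 0 < T -> `|m| < 1 ->
  exists rho l, [/\ 0 < rho, 0 <= l < 1 &
    forall S x, 0 < S -> 0 < x < 1 ->
      norm1 (of_share S x - of_share T xs) < rho ->
      forall n, norm1 (iter n g (of_share S x) - of_share T xs) <=
        `|S - T| + 2 * norm1 (of_share S x - of_share T xs) * l ^+ n].
Proof.
move=> T0 m1; pose l := (`|m| + 1) / 2.
have m0 := normr_ge0 m.
have ml : `|m| < l by rewrite /l; lra.
have l0 : 0 <= l by rewrite /l; lra.
have l1 : l < 1 by rewrite /l; lra.
have [r r0 hc] := is_derive_contract Dh ml.
exists (Num.min (T / 2) (T * r / 2)), l; split.
- by rewrite lt_min !divr_gt0// mulr_gt0.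
- by rewrite l0.
- move=> S x S0 x01; set N := norm1 _; rewrite lt_min => /andP[NT Nr] n.
  have SN : `|S - T| <= N by exact: total_le_norm1.
  have xN : S * `|x - xs| <= N by exact: share_le_norm1.
  have TS : T / 2 < S by move: SN; rewrite ler_norml; lra.
  have xr : `|x - xs| < r.
    rewrite -(ltr_pM2l S0) (le_lt_trans xN)// (lt_trans Nr)//.
    by rewrite mulrAC ltr_pM2r.
  rewrite /g iter_mprk22ncs_of_share// -/h.
  rewrite (le_trans (norm1_le_total_share _ _ _ _))// lerD2l -mulrA ler_pM2l//.
  have l01 : 0 <= l <= 1 by rewrite l0 ltW.
  rewrite (@le_trans _ _ (S * (l ^+ n * `|x - xs|)))//.
    by rewrite ler_pM2l//; exact: (iter_contract l01 hxs hc).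
  by rewrite mulrCA mulrC ler_wpM2r// exprn_ge0.
Qed.

(** Starting values with the total [T] and a share slightly off the fixed point
are expelled. *)
Lemma expanding_multiplier_escape T : 0 < T -> 1 < `|m| ->
  exists2 e, 0 < e & forall d, 0 < d -> exists2 y,
    positive_vec y /\ norm1 (y - of_share T xs) < d &
    exists n, e <= norm1 (iter n g y - of_share T xs).
Proof.
move=> T0 m1; pose l := (`|m| + 1) / 2.
have ml : l < `|m| by rewrite /l; lra.
have l1 : 1 < l by rewrite /l; lra.
have [r r0 he] := is_derive_expand Dh ml.
have Tr0 : 0 < T * r by rewrite mulr_gt0.
exists (T * r) => // d d0; have [xs0 xs1] := andP xs01.
(* The shift eta keeps the share below 1 and the 1-norm, 2 T eta, below d. *)
pose eta := Num.min (1 - xs) (d / T / 2) / 2.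
have q0 : 0 < d / T / 2 by rewrite !divr_gt0.
have eta0 : 0 < eta by rewrite divr_gt0// lt_min subr_gt0 xs1.
have eta1 : eta < 1 - xs.
  rewrite ltr_pdivrMr// (@le_lt_trans _ _ (1 - xs))// ?ge_min ?lexx//.
  by move: xs1; lra.
have eta2 : eta < d / T / 2.
  rewrite ltr_pdivrMr// (@le_lt_trans _ _ (d / T / 2))// ?ge_min ?lexx ?orbT//.
  by move: q0; lra.
have x01 : 0 < xs + eta < 1 by move: xs0 eta0 eta1; lra.
exists (of_share T (xs + eta)); first split.
- exact/positive_of_share.
- rewrite (le_lt_trans (norm1_le_total_share _ _ _ _))//.
  rewrite subrr normr0 add0r addrC addKr gtr0_norm//.
  by move: eta2; rewrite !ltr_pdivlMr//; lra.
- have [|n rn] := iter_expand_escape l1 r0 hxs he (t := xs + eta).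
    by rewrite -subr_eq0 addrC addKr gt_eqF.
  exists n; rewrite /g iter_mprk22ncs_of_share// -/h.
  rewrite (le_trans _ (share_le_norm1 _ _ T0 xs01))//.
  by rewrite ler_pM2l.
Qed.

End LinearizedStability.

Theorem corollary3p11 (R : realType)
    (nrm : 'cV[R]_2 -> R) (nrm_norm : is_norm nrm)
    (a b : R) (a_ge0 : 0 <= a) (b_ge0 : 0 <= b) (ab_gt0 : 0 < a + b)
    (ystar : 'cV[R]_2) (ystar_pos : positive_vec ystar)
    (ystar_steady : sysA a b *m ystar = 0)
    (alpha : R) (alpha_ge : 2^-1 <= alpha) (dt : R) (dt_gt0 : 0 < dt) :
  (alpha < 1 -> exists! t : R, critical_step a b alpha t) /\
  forall dtstar : R, (alpha < 1 -> critical_step a b alpha dtstar) ->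
  let g := mprk22ncs_map (lin_p a b) (lin_d a b) alpha dt in
  [/\ (1 <= alpha \/ (alpha < 1 /\ dt < dtstar) ->
        stable_fixed_point nrm g ystar),
      (1 <= alpha \/ (alpha < 1 /\ dt < dtstar) ->
        exists2 delta : R, 0 < delta &
          forall y0 : 'cV[R]_2, positive_vec y0 ->
            norm1 y0 = norm1 ystar -> nrm (y0 - ystar) < delta ->
            (fun n : nat => iter n g y0) @ \oo --> ystar) &
      (alpha < 1 /\ dtstar < dt -> unstable_fixed_point nrm g ystar)].
Proof.
(* As a y_1 = b y_2 with both entries positive, a and b vanish together. *)
have [a0 b0] : 0 < a /\ 0 < b.
  move: (ystar_pos 0) (ystar_pos 1) => p0 p1.
  move/matrixP: (ystar_steady) => /(_ 0 0); rewrite !mxE sum_ord2 !mxE /= => ay.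
  have {}ay : a * ystar 0 0 = b * ystar 1 0 by move: ay; lra.
  have iff : (0 < a) = (0 < b) by rewrite -(pmulr_lgt0 a p0) ay pmulr_lgt0.
  suff : 0 < b by rewrite iff.
  rewrite lt_neqAle b_ge0 andbT; apply/eqP => bz.
  by move: ab_gt0; rewrite -bz addr0 iff -bz ltxx.
split=> [|dtstar crit g]; first exact: critical_step_exists.
have al0 : 0 < alpha by lra.
have A0 : 0 < dt * a by exact: mulr_gt0.
have B0 : 0 < dt * b by exact: mulr_gt0.
set T := norm1 ystar.
have T0 : 0 < T by rewrite /T norm1_positive// addr_gt0.
have ysE := steady_of_share a0 b0 dt_gt0 ystar_pos ystar_steady.
rewrite -/T in ysE; set xs := dt * b / _ in ysE.
have gys : g ystar = ystar by rewrite ysE; exact: share_fixed_point.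
have [c [C [c0 C0 cP CP]]] := norm1_equiv nrm_norm.
(* Stability and convergence both come from the same bound on the iterates. *)
have contr : 1 <= alpha \/ (alpha < 1 /\ dt < dtstar) ->
    exists rho l, [/\ 0 < rho, 0 <= l < 1 & forall y, positive_vec y ->
      norm1 (y - ystar) < rho -> forall n, norm1 (iter n g y - ystar) <=
        `|norm1 y - T| + 2 * norm1 (y - ystar) * l ^+ n].
  move=> small.
  have m1 : `|share_mult alpha (dt * a) (dt * b)| < 1.
    rewrite ltr_norml share_mult_lt1// share_mult_gtN1// andbT.
    exact: (stab_num_gt0 a0 b0 alpha_ge dt_gt0 crit small).
  have [rho [l [rho0 l01 H]]] :=
    contracting_multiplier_bound a0 b0 alpha_ge dt_gt0 T0 m1.
  exists rho, l; split=> // y yp.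
  have S0 : 0 < norm1 y by rewrite norm1_positive// addr_gt0.
  have yE : y = of_share (norm1 y) (y 0 0 / norm1 y).
    by rewrite norm1_positive// -vec_of_share// gt_eqF// addr_gt0.
  have := H (norm1 y) (y 0 0 / norm1 y) S0; rewrite -yE -ysE; apply.
  by apply/(positive_of_share _ S0); rewrite -yE.
split=> [/contr|/contr|[al1 lt]].
- move=> [rho [l [rho0 /andP[l0 l1] H]]]; split=> // eps eps0.
  (* As l ^+ n <= 1, the bound is at most 3 times the initial distance. *)
  exists (c * Num.min rho (eps / C / 3)).
    by rewrite mulr_gt0// lt_min rho0 !divr_gt0.
  move=> y yp yd n.
  have : norm1 (y - ystar) < Num.min rho (eps / C / 3).
    by rewrite -(ltr_pM2l c0) (le_lt_trans (cP _)).
  rewrite lt_min => /andP[yrho yeps].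
  rewrite (le_lt_trans (CP _))// mulrC -ltr_pdivlMr//.
  rewrite (le_lt_trans (H _ yp yrho n))//.
  have Sd : `|norm1 y - T| <= norm1 (y - ystar).
    rewrite /T (norm1_positive yp) (norm1_positive ystar_pos) norm1E !mxE
      opprD addrACA.
    exact: ler_normD.
  have N0 : 0 <= norm1 (y - ystar) by exact: le_trans Sd.
  have : 2 * norm1 (y - ystar) * l ^+ n <= 2 * norm1 (y - ystar).
    by rewrite ler_piMr ?mulr_ge0// exprn_ile1// ltW.
  by move: yeps; rewrite ltr_pdivlMr//; lra.
- move=> [rho [l [rho0 /andP[l0 l1] H]]].
  exists (c * rho); first exact: mulr_gt0.
  move=> y yp yT yd.
  have yrho : norm1 (y - ystar) < rho.
    by rewrite -(ltr_pM2l c0) (le_lt_trans (cP _)).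
  apply: (@cvg_norm1 _ _ _ (2 * norm1 (y - ystar)) l); first by rewrite ger0_norm.
  by move=> n; have := H _ yp yrho n; rewrite yT subrr normr0 add0r.
- split=> // stab.
  have m1 : 1 < `|share_mult alpha (dt * a) (dt * b)|.
    rewrite ltr_normr; apply/orP; right; rewrite ltrNr share_mult_ltN1//.
    exact: (stab_num_lt0 a0 b0 alpha_ge (crit al1) lt).
  have [e e0 H] := expanding_multiplier_escape a0 b0 alpha_ge dt_gt0 T0 m1.
  rewrite -ysE in H.
  have [d d0 dP] := stab (c * e) (mulr_gt0 c0 e0).
  have [y [yp yd] [n en]] := H (d / C) (divr_gt0 d0 C0).
  have : nrm (iter n g y - ystar) < c * e.
    by apply: dP => //; rewrite (le_lt_trans (CP _))// mulrC -ltr_pdivlMr.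
  move=> /(le_lt_trans (cP _)); rewrite ltr_pM2l// => /lt_le_trans.
  by move=> /(_ _ en); rewrite ltxx.
Qed.
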